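(* Let $\mathcal K$ be a (possibly weighted) simplicial complex and let $k\ge 1$. The linear system $L_k\boldsymbol x=\boldsymbol f$ can be reduced to a sequence of consecutive least square problems for isolated up-Laplacians. Precisely, $\boldsymbol x$ is a solution of the system $$L_k\boldsymbol x=\boldsymbol f\qquad\text{s.t.}\qquad \boldsymbol x,\boldsymbol f\perp\ker L_k$$ if and only if it can be written as $\boldsymbol x=B_k^\top\boldsymbol u+\boldsymbol x_2$, where $$\widehat{\boldsymbol u}=\operatorname*{arg\,min}_{\boldsymbol z}\big\|L^{\uparrow}_{k-1}\boldsymbol z-B_k\boldsymbol f_1\big\|,\qquad \boldsymbol u=\operatorname*{arg\,min}_{\boldsymbol z}\big\|L^{\uparrow}_{k-1}\boldsymbol z-\widehat{\boldsymbol u}\big\|,\qquad \boldsymbol x_2=\operatorname*{arg\,min}_{\boldsymbol y}\big\|L^{\uparrow}_k\boldsymbol y-\boldsymbol f_2\big\|$$ and $\boldsymbol f=\boldsymbol f_1+\boldsymbol f_2$ with $\boldsymbol f_1=B_k^\top\boldsymbol z_1$, $\ \boldsymbol z_1=\operatorname*{arg\,min}_{\boldsymbol z}\big\|L^{\uparrow}_{k-1}\boldsymbol z-B_k\boldsymbol f\big\|$.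
   Context: A simplicial complex $\mathcal K$ on finitely many vertices is a collection of vertex sets, called simplices, closed under taking subsets. A simplex with $k+1$ vertices has order $k$; $\mathcal V_k(\mathcal K)$ is the set of simplices of order $k$ and $m_k=|\mathcal V_k(\mathcal K)|$. Fix an ordering and orientation of the simplices of each order. The unweighted boundary matrix, of size $m_{k-1}\times m_k$, represents the operator $\partial_k[v_1,\dots,v_{k+1}]=\sum_{i=1}^{k+1}(-1)^{i-1}[v_1,\dots,v_{i-1},v_{i+1},\dots,v_{k+1}]$. Given weight functions $w_k:\mathcal V_k(\mathcal K)\to\mathbb R_+\cup\{0\}$, let $W_k$ be the diagonal matrix with $(W_k)_{ii}=\sqrt{w_k(\sigma_i)}$; the weighted boundary matrix is obtained from the unweighted one by multiplying by $W_{k-1}^{-1}$ on the left and by $W_k$ on the right. $B_k$ denotes the (possibly weighted) boundary matrix; it satisfies $B_kB_{k+1}=0$. The $k$-th order Laplacian is $L_k=B_k^\top B_k+B_{k+1}B_{k+1}^\top$, and $L^{\uparrow}_k=B_{k+1}B_{k+1}^\top$ is the up-Laplacian; in particular $L^{\uparrow}_{k-1}=B_kB_k^\top$. Vectors $\boldsymbol x,\boldsymbol f,\boldsymbol f_1,\boldsymbol f_2,\boldsymbol x_2,\boldsymbol y$ lie in $\mathbb R^{m_k}$ and $\boldsymbol z,\boldsymbol z_1,\boldsymbol u,\widehat{\boldsymbol u}$ in $\mathbb R^{m_{k-1}}$; the norm is Euclidean, and the minimizations are written without constraints on $\boldsymbol z$ and $\boldsymbol y$.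
   Formalization: x_2 is taken to be the least-norm minimizer, since with an arbitrary minimizer the ''if'' direction fails (single edge, k=1); f ⊥ ker L_k is assumed for both sides of the equivalence, and weights of orders k-1 and k are assumed nonzero so that the inverse weight matrices exist. *)

(* Defs.v *)
From HB Require Import structures.
From mathcomp Require Import all_boot all_order all_algebra all_fingroup.

Set Implicit Arguments.
Unset Strict Implicit.
Unset Printing Implicit Defensive.

Import Order.TTheory GRing.Theory Num.Theory.
Local Open Scope ring_scope.

Section Complex.
Variable V : finType.
Implicit Type K : {set {set V}}.

Definition simplicial_complex K : Prop :=
  forall s t : {set V}, s \in K -> t \subset s -> t \in K.

Definition simplices K (k : nat) : {set {set V}} :=
  [set s in K | #|s| == k.+1].

Definition nsimplices K (k : nat) : nat := #|simplices K k|.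

Definition vertices n (s : 'I_n -> V) : {set V} := [set s a | a : 'I_n].

(* A choice of ordering and orientation for the simplices of each order:
   [o k i] is the ordered vertex list [v_0, ..., v_k] that orients the [i]-th
   simplex of order [k].  Since the index type has exactly as many elements as
   there are simplices of order [k], injectivity makes [i |-> vertices (o k i)]
   an enumeration of all of them. *)
Definition ordered_orientation K
    (o : forall k : nat, 'I_(nsimplices K k) -> 'I_k.+1 -> V) : Prop :=
  forall k : nat,
    [/\ forall i, injective (o k i),
        forall i, vertices (o k i) \in simplices K k
      & injective (fun i => vertices (o k i))].

End Complex.

Section Matrices.
Variables (R : rcfType) (V : finType) (K : {set {set V}}).
Variable o : forall k : nat, 'I_(nsimplices K k) -> 'I_k.+1 -> V.
Variable w : {set V} -> R.

(* The coefficient of the oriented simplex [t] in the oriented simplex [s]: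
   the sign of the permutation carrying [t] to [s], and 0 when [s] and [t] do
   not have the same vertices.  For injective [s] and [t] at most one
   permutation contributes. *)
Definition orientation_sign n (s t : 'I_n -> V) : R :=
  \sum_(p : 'S_n | [forall a, s a == t (p a)]) (-1) ^+ p.

(* The matrix of the operator from order [k.+1] to order [k]. *)
Definition boundary_succ (k : nat) :
    'M[R]_(nsimplices K k, nsimplices K k.+1) :=
  \matrix_(i, j) \sum_(l < k.+2)
    (-1) ^+ l * orientation_sign (fun a => o j (lift l a)) (o i).

(* In order 0 there is no boundary, so the matrix is set to 0. *)
Definition unweighted_boundary (k : nat) :
    'M[R]_(nsimplices K k.-1, nsimplices K k) :=
  match k with
  | 0 => 0
  | j.+1 => boundary_succ j
  end.

Definition weight_mx (k : nat) : 'M[R]_(nsimplices K k) :=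
  diag_mx (\row_i Num.sqrt (w (vertices (o i)))).

(* The unweighted case is [w = fun=> 1]. *)
Definition boundary (k : nat) : 'M[R]_(nsimplices K k.-1, nsimplices K k) :=
  invmx (weight_mx k.-1) *m unweighted_boundary k *m weight_mx k.

Definition up_laplacian (k : nat) : 'M[R]_(nsimplices K k) :=
  boundary k.+1 *m (boundary k.+1)^T.

Definition laplacian (k : nat) : 'M[R]_(nsimplices K k) :=
  (boundary k)^T *m boundary k + up_laplacian k.

End Matrices.

Section LeastSquares.
Variable R : rcfType.

Definition dot n (x y : 'cV[R]_n) : R := \sum_i x i 0 * y i 0.

Definition enorm n (x : 'cV[R]_n) : R := Num.sqrt (dot x x).

Definition perp_ker m n (A : 'M[R]_(m, n)) (x : 'cV[R]_n) : Prop :=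
  forall v : 'cV[R]_n, A *m v = 0 -> dot x v = 0.

Definition is_argmin n (F : 'cV[R]_n -> R) (x : 'cV[R]_n) : Prop :=
  forall z : 'cV[R]_n, F x <= F z.

(* A rank-deficient least square problem has many minimizers; this selects the
   one of least Euclidean norm. *)
Definition is_least_norm_argmin n (F : 'cV[R]_n -> R) (x : 'cV[R]_n) : Prop :=
  is_argmin F x /\ forall z : 'cV[R]_n, is_argmin F z -> enorm x <= enorm z.

End LeastSquares.

(* Main.v *)
Require Import Defs.
From HB Require Import structures.
From mathcomp Require Import all_boot all_order all_algebra all_fingroup.
From mathcomp Require Import ring lra.

Set Implicit Arguments.
Unset Strict Implicit.
Unset Printing Implicit Defensive.

Import Order.TTheory GRing.Theory Num.Theory.
Local Open Scope ring_scope.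

(* Write A = B_k and C = B_{k+1}, so that A C = 0.

   Least squares: every minimizer of |M z - b| satisfies the normal equations,
   and the component of f in the range of A^T is A^T z_1 with A A^T z_1 = A f.
   Since L is symmetric, x is orthogonal to ker L iff x = L y, and then u = A y
   and x_2 = C C^T y are solutions of the reduced problems; the ranges of A^T
   and C are orthogonal, so L acts separately on the two components.

   A C = 0: the entries of an unweighted boundary matrix are determinants,
   namely of the 0-1 matrix comparing the vertices of the two simplices,
   bordered by a column of ones (expand along this column).  The entries of the
   product of two boundary matrices are then determinants with two columns of
   ones. *)

(** * Determinants bordered by a column of ones *)

Section BorderedDeterminants.
Variable R : comNzRingType.

Lemma det_border n (M : 'M[R]_(n.+1, n)) :
  \det (row_mx (const_mx 1 : 'cV_n.+1) M : 'M_n.+1) =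
  \sum_(l < n.+1) (-1) ^+ l * \det (row' l M).
Proof.
rewrite (expand_det_col _ 0); apply: eq_bigr => l _.
have E0 : (0 : 'I_n.+1) = lshift n (0 : 'I_1) by apply: val_inj.
rewrite {1}E0 (@row_mxEl R n.+1 1 n) mxE mul1r /cofactor addn0.
congr (_ * \det _); apply/matrixP => a b; rewrite !mxE.
have -> : lift 0 b = rshift 1 b :> 'I_(1 + n) by apply: val_inj.
by rewrite (unsplitK (inr b)).
Qed.

Variable V : eqType.

Definition incidence n m (s : 'I_n -> V) (t : 'I_m -> V) : 'M[R]_(n, m) :=
  \matrix_(a, b) (s a == t b)%:R.

Definition bordered_incidence n (s : 'I_n.+1 -> V) (t : 'I_n -> V)
    : 'M[R]_n.+1 :=
  row_mx (const_mx 1 : 'cV_n.+1) (incidence s t).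

(** A column of ones is invariant under row permutations, so reordering the vertices of [s]
    multiplies the whole bordered matrix by a permutation matrix. *)
Lemma det_bordered_incidence_perm n (s : 'I_n.+1 -> V) (t : 'I_n -> V)
    (p : 'S_n.+1) :
  \det (bordered_incidence (fun a => s (p a)) t) =
  (-1) ^+ p * \det (bordered_incidence s t).
Proof.
rewrite -det_perm -det_mulmx -row_permE; congr (\det _).
by apply/matrixP => a b; rewrite !mxE; case: split => c; rewrite !mxE.
Qed.

Lemma alternating_sum_bordered n (s : 'I_n.+2 -> V) (t : 'I_n -> V) :
  \sum_(l < n.+2)
    (-1) ^+ l * \det (bordered_incidence (fun a => s (lift l a)) t) = 0.
Proof.
pose N : 'M[R]_(n.+2, n.+1) := row_mx (const_mx 1 : 'cV_n.+2) (incidence s t).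
transitivity (\det (row_mx (const_mx 1 : 'cV_n.+2) N : 'M_n.+2)).
  rewrite det_border; apply: eq_bigr => l _; congr (_ * \det _).
  by apply/matrixP => a b; rewrite !mxE; case: split => c; rewrite !mxE.
rewrite -det_tr.
(* The two columns of ones have become equal rows after the transposition. *)
apply: (@determinant_alternate _ _ _ (lshift n.+1 (0 : 'I_1))
                                     (rshift 1 (lshift n (0 : 'I_1)))) => // a.
rewrite !mxE (unsplitK (inl _)) (unsplitK (inr _)).
by rewrite !mxE (unsplitK (inl _)) mxE.
Qed.

End BorderedDeterminants.

(** * Boundary matrices and their vanishing products *)

Section Boundary.
Variables (R : rcfType) (V : finType) (K : {set {set V}}).
Variable o : forall k : nat, 'I_(nsimplices K k) -> 'I_k.+1 -> V.
Variable w : {set V} -> R.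

(** In the Leibniz formula, a permutation that does not carry [t] to [s] has a zero factor. *)
Lemma orientation_signE n (s t : 'I_n -> V) :
  orientation_sign R s t = \det (incidence R s t).
Proof.
rewrite /orientation_sign /determinant big_mkcond /=.
apply: eq_bigr => p _; case: ifPn => [/forallP h|].
  by rewrite big1 ?mulr1 // => a _; rewrite mxE h.
rewrite negb_forall => /existsP[a ha].
by rewrite (bigD1 a) //= mxE (negPf ha) mul0r mulr0.
Qed.

Lemma orientation_sign_perm n (t : 'I_n -> V) (p : 'S_n) :
  injective t -> orientation_sign R (fun a => t (p a)) t = (-1) ^+ p.
Proof.
move=> t_inj; rewrite /orientation_sign (big_pred1 p) // => q /=.
apply/forallP/eqP => [h|-> a //]; apply/permP => a.
by apply: t_inj; rewrite (eqP (h a)).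
Qed.

Lemma orientation_sign_neq0 n (s t : 'I_n -> V) :
  orientation_sign R s t != 0 -> exists p : 'S_n, s =1 t \o p.
Proof.
rewrite /orientation_sign => h.
case: (pickP (fun p : 'S_n => [forall a, s a == t (p a)])) =>
  [p /forallP hp|h0].
  by exists p => a; rewrite /= (eqP (hp a)).
by rewrite big_pred0 ?eqxx in h.
Qed.

Lemma vertices_perm n (t : 'I_n -> V) (p : 'S_n) :
  vertices (t \o p) = vertices t.
Proof.
apply/setP => v; apply/imsetP/imsetP => [[a _ ->]|[a _ ->]].
  by exists (p a).
by exists (p^-1%g a); rewrite //= permKV.
Qed.

Lemma eq_vertices_perm n (s t : 'I_n -> V) :
  injective s -> vertices s = vertices t -> exists p : 'S_n, s =1 t \o p.
Proof.
move=> s_inj e.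
have h a : exists b, s a == t b.
  have : s a \in vertices t by rewrite -e imset_f.
  by case/imsetP => b _ ->; exists b.
pose q a := xchoose (h a).
have hq a : s a = t (q a) by apply/eqP; exact: (xchooseP (h a)).
have q_inj : injective q by move=> a b hab; apply: s_inj; rewrite !hq hab.
by exists (perm q_inj) => a; rewrite /= permE hq.
Qed.

Lemma boundary_succE k i j :
  boundary_succ R o k i j = \det (bordered_incidence R (o j) (o i)).
Proof.
rewrite mxE det_border; apply: eq_bigr => l _; congr (_ * _).
rewrite orientation_signE; congr (\det _).
by apply/matrixP => a b; rewrite !mxE.
Qed.

Hypothesis hK : simplicial_complex K.
Hypothesis ho : ordered_orientation o.

Lemma simplices_enumerated k s :
  s \in simplices K k -> exists i : 'I_(nsimplices K k), vertices (o i) = s.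
Proof.
have [_ o_in o_inj] := ho k.
have /eqP <- : [set vertices (o i) | i : 'I_(nsimplices K k)] == simplices K k.
  rewrite eqEcard card_imset // card_ord leqnn andbT.
  by apply/subsetP => _ /imsetP[i _ ->].
by case/imsetP => i _ ->; exists i.
Qed.

(** Only the enumerated simplex with the vertices of [t] contributes, and its sign is the one that
    reordering its vertices into [t] puts on the determinant. So each face of a simplex may keep its
    induced orientation instead of the chosen one. *)
Lemma sum_orientation_sign k (t : 'I_k.+2 -> V) (u : 'I_k.+1 -> V) :
  injective t -> vertices t \in simplices K k.+1 ->
  \sum_j orientation_sign R t (o j) * \det (bordered_incidence R (o j) u) =
  \det (bordered_incidence R t u).
Proof.
move=> t_inj /simplices_enumerated[j0 hj0].
have [oj_inj _ o_inj] := ho k.+1.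
have [p hp] := eq_vertices_perm t_inj (esym hj0).
rewrite (bigD1 j0) //= big1 ?addr0 => [|j nj].
  have -> : orientation_sign R t (o j0) = (-1) ^+ p.
    rewrite -(orientation_sign_perm p (oj_inj j0)) !orientation_signE.
    by congr (\det _); apply/matrixP => a b; rewrite !mxE hp.
  rewrite -det_bordered_incidence_perm; congr (\det _).
  by apply/matrixP => a b; rewrite !mxE; case: split => c; rewrite !mxE ?hp.
have [->|/orientation_sign_neq0[q hq]] := eqVneq (orientation_sign R t (o j)) 0.
  by rewrite mul0r.
case/eqP: nj; apply: o_inj; rewrite hj0 -(vertices_perm (o j) q).
by apply: eq_imset => a; rewrite hq.
Qed.

Lemma boundary_succ_succ k :
  boundary_succ R o k *m boundary_succ R o k.+1 = 0.
Proof.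
apply/matrixP => i h; rewrite !mxE.
have [oh_inj oh_in _] := ho k.+2.
rewrite -[RHS](alternating_sum_bordered R (o h) (o i)).
under eq_bigr => j _ do rewrite boundary_succE mxE mulr_sumr.
rewrite exchange_big; apply: eq_bigr => l _ /=.
have face_inj : injective (fun a => o h (lift l a)).
  exact: inj_comp (oh_inj h) (@lift_inj _ l).
rewrite -(sum_orientation_sign _ face_inj) ?mulr_sumr.
  by apply: eq_bigr => j _; rewrite mulrCA [X in _ * X]mulrC.
rewrite inE card_imset // card_ord eqxx andbT.
have := oh_in h; rewrite inE => /andP[/hK + _]; apply.
by apply/subsetP => _ /imsetP[a _ ->]; rewrite imset_f.
Qed.

Lemma weight_mx_unit k :
  (forall s, s \in simplices K k -> 0 < w s) -> weight_mx o w k \in unitmx.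
Proof.
move=> w_gt0; have [_ o_in _] := ho k.
rewrite unitmxE det_diag unitfE; apply/prodf_neq0 => i _.
by rewrite mxE sqrtr_eq0 -ltNge w_gt0.
Qed.

Lemma boundary_boundary k :
  (forall s, s \in simplices K k -> 0 < w s) ->
  boundary o w k *m boundary o w k.+1 = 0.
Proof.
(* In order 0 the boundary is 0 by convention; in higher orders the weight matrix and its inverse
   cancel between the two factors. *)
case: k => [|k] w_gt0; first by rewrite /boundary /= mulmx0 !mul0mx.
rewrite /boundary /= !mulmxA mulmxK ?weight_mx_unit //.
by rewrite -[X in X *m _]mulmxA boundary_succ_succ mulmx0 mul0mx.
Qed.

End Boundary.

(** * Orthogonality and least squares *)

Section LinearAlgebra.
Variable R : rcfType.

Lemma dotE n (x y : 'cV[R]_n) : dot x y = (x^T *m y) 0 0.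
Proof. by rewrite mxE; apply: eq_bigr => i _; rewrite mxE. Qed.

Lemma dotC n (x y : 'cV[R]_n) : dot x y = dot y x.
Proof. by apply: eq_bigr => i _; rewrite mulrC. Qed.

Lemma dot0 n (x : 'cV[R]_n) : dot x 0 = 0.
Proof. by rewrite /dot big1 // => i _; rewrite mxE mulr0. Qed.

Lemma dotDr n (x y z : 'cV[R]_n) : dot x (y + z) = dot x y + dot x z.
Proof. by rewrite !dotE mulmxDr mxE. Qed.

Lemma dotZr n a (x y : 'cV[R]_n) : dot x (a *: y) = a * dot x y.
Proof. by rewrite !dotE -scalemxAr mxE. Qed.

Lemma dotMr m n (A : 'M[R]_(m, n)) x y : dot x (A *m y) = dot (A^T *m x) y.
Proof. by rewrite !dotE trmx_mul trmxK mulmxA. Qed.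

Lemma dot_ge0 n (x : 'cV[R]_n) : 0 <= dot x x.
Proof. by apply: sumr_ge0 => i _; apply: sqr_ge0. Qed.

Lemma dot_eq0 n (x : 'cV[R]_n) : dot x x = 0 -> x = 0.
Proof.
move=> /eqP; rewrite psumr_eq0 => [/allP h|i _]; last exact: sqr_ge0.
apply/colP => i; have := h i (mem_index_enum i).
by rewrite /= mulf_eq0 orbb mxE => /eqP.
Qed.

Lemma enorm_le n m (x : 'cV[R]_n) (y : 'cV[R]_m) :
  (enorm x <= enorm y) = (dot x x <= dot y y).
Proof. by rewrite ler_sqrt ?dot_ge0. Qed.

Lemma dotDD n (x y : 'cV[R]_n) :
  dot (x + y) (x + y) = dot x x + dot x y *+ 2 + dot y y.
Proof.
by rewrite dotDr ![dot (x + y) _]dotC !dotDr (dotC y x) mulr2n !addrA.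
Qed.

Lemma enorm_perp_le n (x y : 'cV[R]_n) :
  dot x y = 0 -> enorm x <= enorm (x + y).
Proof. by move=> h; rewrite enorm_le dotDD h mul0rn addr0 lerDl dot_ge0. Qed.

Lemma perp_of_minimal n (x v : 'cV[R]_n) :
  (forall t : R, enorm x <= enorm (x + t *: v)) -> dot x v = 0.
Proof.
move=> h; set g := dot x v; set q := dot v v.
have q_ge0 : 0 <= q := dot_ge0 v.
have q1 : 0 < q + 1 by rewrite ltr_wpDl.
(* The optimal step would be [- g / q]; the denominator [q + 1] is never zero, and the squared norm
   still changes by [- (g ^+ 2 * (q + 2)) / (q + 1) ^+ 2]. *)
have := h (- g / (q + 1)); rewrite enorm_le dotDD !dotZr [dot (_ *: v) v]dotC.
rewrite dotZr -/g -/q -addrA lerDl => h0.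
have : 0 <= - (g ^+ 2 * (q + 2)) / (q + 1) ^+ 2.
  by apply: (le_trans h0); rewrite le_eqVlt; apply/orP; left; apply/eqP; field; lra.
rewrite pmulr_lge0 ?invr_gt0 ?exprn_gt0 // oppr_ge0 => hg.
apply/eqP; rewrite -sqrf_eq0 eq_le sqr_ge0 andbT.
by rewrite -(pmulr_lle0 _ (_ : 0 < q + 2)) //; lra.
Qed.

(** Minimality along the gradient direction [M^T *m (M *m z - b)] makes the residual orthogonal to
    the image of this direction under [M], so the gradient has norm 0. *)
Lemma normal_equations m n (M : 'M[R]_(m, n)) b z :
  is_argmin (fun z => enorm (M *m z - b)) z -> M^T *m (M *m z - b) = 0.
Proof.
move=> h; apply: dot_eq0; rewrite -dotMr; apply: perp_of_minimal => t.
have := h (z + t *: (M^T *m (M *m z - b))).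
by rewrite [M *m (z + _)]mulmxDr -scalemxAr addrAC.
Qed.

Lemma gram_eq0 m n (A : 'M[R]_(m, n)) (x : 'cV[R]_n) :
  A^T *m (A *m x) = 0 -> A *m x = 0.
Proof. by move=> h; apply: dot_eq0; rewrite dotMr h dotC dot0. Qed.

Lemma argmin_range m n (M : 'M[R]_(m, n)) y z :
  is_argmin (fun z => enorm (M *m z - M *m y)) z -> M *m z = M *m y.
Proof.
move=> /normal_equations; rewrite -mulmxBr => /gram_eq0/eqP.
by rewrite mulmxBr subr_eq0 => /eqP.
Qed.

Lemma argmin_exact m n (M : 'M[R]_(m, n)) b z :
  M *m z = b -> is_argmin (fun z => enorm (M *m z - b)) z.
Proof.
by move=> h z'; rewrite enorm_le h subrr dot0 dot_ge0.
Qed.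

(** The columns of [cokermx L] lie in the kernel of [L], so [x^T] annihilates them and is in the row
    space of [L]; symmetry turns rows into columns. *)
Lemma perp_ker_range n (L : 'M[R]_n) (x : 'cV[R]_n) :
  L^T = L -> perp_ker L x -> exists y, x = L *m y.
Proof.
move=> L_sym hx.
have /submxP[D hD] : (x^T <= L)%MS.
  rewrite submxE; apply/eqP/rowP => j; rewrite [RHS]mxE.
  rewrite -(hx (col j (cokermx L))).
    by rewrite dotE colE [in RHS]mulmxA -colE [RHS]mxE.
  by rewrite colE mulmxA mulmx_coker mul0mx.
by exists D^T; rewrite -[x]trmxK hD trmx_mul L_sym.
Qed.

Lemma gram_injective m n (A : 'M[R]_(m, n)) (x y : 'cV[R]_n) :
  A^T *m A *m x = A^T *m A *m y -> A *m x = A *m y.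
Proof.
move=> h; apply/eqP; rewrite -subr_eq0 -mulmxBr; apply/eqP/gram_eq0.
by rewrite mulmxA mulmxBr h subrr.
Qed.

Lemma gram_tr_injective m n (A : 'M[R]_(m, n)) (x y : 'cV[R]_m) :
  A *m A^T *m x = A *m A^T *m y -> A^T *m x = A^T *m y.
Proof. by move=> h; apply: gram_injective; rewrite trmxK. Qed.

(** * The Laplacian of two matrices with zero product *)

Variables (m n p : nat) (A : 'M[R]_(m, n)) (C : 'M[R]_(n, p)).
Hypothesis AC : A *m C = 0.
Let L := A^T *m A + C *m C^T.

Lemma hodge_laplacian_sym : L^T = L.
Proof. by rewrite /L linearD /= !trmx_mul !trmxK. Qed.

Lemma trC_trA : C^T *m A^T = 0.
Proof. by rewrite -trmx_mul AC trmx0. Qed.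

(** The quadratic form [dot v (L *m v)] is the sum of the squared norms of [A *m v] and
    [C^T *m v]. *)
Lemma hodge_laplacian_ker (v : 'cV[R]_n) :
  L *m v = 0 -> A *m v = 0 /\ C^T *m v = 0.
Proof.
move=> Lv; have : dot v (L *m v) = 0 by rewrite Lv dot0.
rewrite mulmxDl dotDr -!mulmxA.
rewrite [dot v (A^T *m _)]dotMr [dot v (C *m _)]dotMr trmxK => /eqP.
by rewrite paddr_eq0 ?dot_ge0 // => /andP[/eqP/dot_eq0 ? /eqP/dot_eq0 ?].
Qed.

Lemma hodge_least_squares f x : perp_ker L f ->
  (L *m x = f /\ perp_ker L x) <->
  exists z1 uhat u f1 f2 x2,
    [/\ x = A^T *m u + x2,
        [/\ is_argmin (fun z => enorm (A *m A^T *m z - A *m f1)) uhat,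
            is_argmin (fun z => enorm (A *m A^T *m z - uhat)) u
          & is_least_norm_argmin (fun y => enorm (C *m C^T *m y - f2)) x2],
        f = f1 + f2,
        f1 = A^T *m z1
      & is_argmin (fun z => enorm (A *m A^T *m z - A *m f)) z1].
Proof.
have perpL g : perp_ker L (L *m g).
  by move=> v Lv; rewrite dotC dotMr hodge_laplacian_sym Lv dotC dot0.
have LE g : L *m g = A^T *m (A *m g) + C *m (C^T *m g).
  by rewrite mulmxDl !mulmxA.
have AL g : A *m (L *m g) = A *m A^T *m (A *m g).
  by rewrite LE mulmxDr !mulmxA AC !mul0mx addr0.
have CL g : C^T *m (L *m g) = C^T *m C *m (C^T *m g).
  by rewrite LE mulmxDr !mulmxA trC_trA !mul0mx add0r.
move=> f_perp; split=> [[Lx x_perp]|].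
  have [y x_y] := perp_ker_range hodge_laplacian_sym x_perp.
  (* [f1] and [f2] are the two terms of [L *m x]. Applying [A] to [f = L *m x] and to [x = L *m y]
     yields the solutions [z1 = uhat = A *m x] and [u = A *m y]. *)
  exists (A *m x), (A *m x), (A *m y), (A^T *m (A *m x)).
  exists (C *m (C^T *m x)), (C *m (C^T *m y)).
  have Cx2 : C *m C^T *m (C *m (C^T *m y)) = C *m (C^T *m x).
    by rewrite [in RHS]x_y CL !mulmxA.
  split=> //; first by rewrite -LE.
  - split; [by apply: argmin_exact; rewrite !mulmxA | |].
      by apply: argmin_exact; rewrite x_y AL.
    split=> [|z]; first exact: argmin_exact.
    (* Another minimizer differs from [x2] by an element of the kernel of [C^T], which is orthogonal
       to [x2] since [x2] is in the range of [C]. *)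
    rewrite -Cx2 => /argmin_range/gram_tr_injective Cz.
    rewrite -(subrK (C *m (C^T *m y)) z) [_ - _ + _]addrC.
    apply: enorm_perp_le.
    by rewrite dotC dotMr mulmxBr Cz subrr dotC dot0.
  - by rewrite -LE.
  by apply: argmin_exact; rewrite -Lx AL.
have [g f_g] := perp_ker_range hodge_laplacian_sym f_perp.
case=> [z1 [uhat [u [f1 [f2 [x2]]]]]].
case=> -> [h_uhat h_u [h_x2 x2_min]] f12 f1_z1 h_z1.
have f1_g : f1 = A^T *m (A *m g).
  rewrite f1_z1; apply: gram_tr_injective; apply: argmin_range.
  by rewrite -AL -f_g.
have f2_g : f2 = C *m C^T *m g.
  by apply: (addrI f1); rewrite -f12 f_g LE f1_g -[in RHS](mulmxA C).
have uhat_z1 : A *m A^T *m uhat = A *m A^T *m z1.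
  by apply: argmin_range; rewrite -mulmxA -f1_z1.
(* An arbitrary [uhat] may fall outside the range of [A *m A^T], so only the normal equations hold
   for [u]; they contain one more factor [A], which is cancelled on the range of [A^T]. *)
have Lu : A^T *m (A *m A^T *m u) = f1.
  rewrite f1_z1; apply: gram_tr_injective; rewrite -uhat_z1.
  have /eqP := normal_equations h_u.
  by rewrite trmx_mul trmxK mulmxBr subr_eq0 => /eqP.
have Cx2 : C *m C^T *m x2 = f2.
  by rewrite f2_g; apply: argmin_range; rewrite -f2_g.
(* Moving [x2] along the kernel of [C^T] keeps it a minimizer, so its least norm forces
   orthogonality. *)
have x2_perp v : C^T *m v = 0 -> dot x2 v = 0.
  move=> Cv; apply: perp_of_minimal => t; apply: x2_min; apply: argmin_exact.
  by rewrite mulmxDr Cx2 -scalemxAr -mulmxA Cv mulmx0 scaler0 addr0.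
(* [A^T *m (A *m x2)] is in the kernel of [C^T], hence orthogonal to [x2]. *)
have Ax2 : A *m x2 = 0.
  apply: dot_eq0; rewrite dotMr dotC; apply: x2_perp.
  by rewrite mulmxA trC_trA mul0mx.
split.
  rewrite mulmxDr !LE Ax2 mulmx0 add0r [A *m (A^T *m u)]mulmxA Lu.
  by rewrite [C^T *m (A^T *m u)]mulmxA trC_trA mul0mx mulmx0 addr0 mulmxA Cx2.
move=> v /hodge_laplacian_ker[Av Cv].
by rewrite dotC dotDr dotMr trmxK Av dotC dot0 add0r dotC x2_perp.
Qed.

End LinearAlgebra.

(* The three problems in z admit any minimizer: the resulting f_1 and B_k^T u
   do not depend on the choice.  The problem in y is different: adding to x_2 an
   element of ker (L_k^up), which contains the range of B_k^T, keeps it a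
   minimizer but changes L_k x in general, so x_2 is the least-norm minimizer.
   Zero weights are excluded only in the orders k - 1 and k, where the inverse
   of the weight matrix is used. *)
Theorem theorem3p1 (R : rcfType) (V : finType) (K : {set {set V}})
    (o : forall k : nat, 'I_(nsimplices K k) -> 'I_k.+1 -> V)
    (w : {set V} -> R) (k : nat)
    (hK : simplicial_complex K) (ho : ordered_orientation o)
    (hw : forall (j : nat) (s : {set V}), s \in simplices K j -> 0 <= w s)
    (hw1 : forall s : {set V}, s \in simplices K k.-1 -> w s != 0)
    (hw2 : forall s : {set V}, s \in simplices K k -> w s != 0)
    (hk : (1 <= k)%N)
    (f : 'cV[R]_(nsimplices K k)) (hf : perp_ker (laplacian o w k) f)
    (x : 'cV[R]_(nsimplices K k)) :
  (laplacian o w k *m x = f /\ perp_ker (laplacian o w k) x)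
  <->
  exists (z1 uhat u : 'cV[R]_(nsimplices K k.-1))
         (f1 f2 x2 : 'cV[R]_(nsimplices K k)),
    [/\ x = (boundary o w k)^T *m u + x2,
        [/\ is_argmin (fun z => enorm (up_laplacian o w k.-1 *m z
                                       - boundary o w k *m f1)) uhat,
            is_argmin (fun z => enorm (up_laplacian o w k.-1 *m z - uhat)) u
          & is_least_norm_argmin
              (fun y => enorm (up_laplacian o w k *m y - f2)) x2],
        f = f1 + f2,
        f1 = (boundary o w k)^T *m z1
      & is_argmin (fun z => enorm (up_laplacian o w k.-1 *m z
                                   - boundary o w k *m f)) z1].
Proof.
(* With [k = k'.+1], the up-Laplacian of order [k.-1] is by computation the product of
   [boundary o w k] and its transpose. *)
case: k hk hw1 hw2 f hf x => // k' _ _ hw2 f hf x.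
apply: hodge_least_squares => //; apply: boundary_boundary => // s hs.
by rewrite lt_def (hw2 _ hs) (hw _ _ hs).
Qed.
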